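(* Let $(p_n)_{n\ge1}$ and $(q_n)_{n\ge1}$ be real sequences with $0<q_n<p_n\le 1$ for all $n$ and $\lim_{n\to\infty}p_n=1$, $\lim_{n\to\infty}q_n=1$. Let $\omega$ be a modulus of continuity and $H_\omega$ the associated function space. Then for every $f\in H_\omega$, $$\lim_{n\to\infty}\left\| L_n^{p_n,q_n}(f;\cdot)-f\right\|_{C_B}=0.$$
   Context: $\mathbb{R}_+=[0,\infty)$. $C_B(\mathbb{R}_+)$ is the space of bounded continuous real functions on $\mathbb{R}_+$ with norm $\|f\|_{C_B}=\sup_{x\ge0}|f(x)|$. A modulus of continuity is a function $\omega$ on $\mathbb{R}_+$ such that: $\omega$ is non-negative and increasing on $\mathbb{R}_+$; $\omega(\delta_1+\delta_2)\le\omega(\delta_1)+\omega(\delta_2)$; and $\lim_{\delta\to0}\omega(\delta)=0$. $H_\omega$ is the space of all real-valued functions $f$ on $\mathbb{R}_+$ satisfying $|f(x)-f(y)|\le\omega\left(\left|\frac{x}{1+x}-\frac{y}{1+y}\right|\right)$ for all $x,y\in\mathbb{R}_+$. For $0<q<p\le1$ and integers $n\ge 0$, the $(p,q)$-integers are $[n]_{p,q}=\frac{p^n-q^n}{p-q}$; $[n]_{p,q}!=[1]_{p,q}[2]_{p,q}\cdots[n]_{p,q}$ with $[0]_{p,q}!=1$; $\binom{n}{k}_{p,q}=\frac{[n]_{p,q}!}{[k]_{p,q}!\,[n-k]_{p,q}!}$ for $0\le k\le n$. For $n\ge1$, $x\ge 0$ and $f:\mathbb{R}_+\to\mathbb{R}$,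 the $(p,q)$-Bleimann–Butzer–Hahn operator is $$L_n^{p,q}(f;x)=\frac{1}{\ell_n^{p,q}(x)}\sum_{k=0}^n f\left(\frac{p^{n-k+1}[k]_{p,q}}{[n-k+1]_{p,q}\,q^k}\right)p^{\frac{(n-k)(n-k-1)}{2}}q^{\frac{k(k-1)}{2}}\binom{n}{k}_{p,q}x^k,\qquad \ell_n^{p,q}(x)=\prod_{s=0}^{n-1}(p^s+q^sx).$$ *)

(* Defs.v *)
From mathcomp Require Import all_boot all_order all_algebra.
From mathcomp Require Import all_classical all_reals all_analysis.
Import Order.TTheory GRing.Theory Num.Theory.
Import numFieldNormedType.Exports.

Set Implicit Arguments.
Unset Strict Implicit.
Unset Printing Implicit Defensive.

Local Open Scope classical_set_scope.
Local Open Scope ring_scope.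

(* Functions on R_+ = [0, +oo[ are represented by functions on R; every notion
   below only looks at their values on [0, +oo[. *)

Section FunctionSpaces.
Context {R : realType}.
Implicit Types f omega : R -> R.

Definition in_CB f : Prop :=
  {within `[0, +oo[, continuous f} /\ [bounded f x | x in `[0, +oo[%classic].

(* Meaningful only for functions satisfying in_CB: the real-valued sup of an
   unbounded set is 0 by convention. *)
Definition normCB f : R := sup [set `|f x| | x in `[0, +oo[%classic].

Definition modulus_of_continuity omega : Prop :=
  [/\ forall d, 0 <= d -> 0 <= omega d,
      forall d1 d2, 0 <= d1 -> d1 <= d2 -> omega d1 <= omega d2,
      forall d1 d2, 0 <= d1 -> 0 <= d2 ->
        omega (d1 + d2) <= omega d1 + omega d2
    & omega d @[d --> 0^'+] --> 0].

Definition in_H omega f : Prop :=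
  forall x y, 0 <= x -> 0 <= y ->
    `|f x - f y| <= omega `|x / (1 + x) - y / (1 + y)|.

End FunctionSpaces.

Section BleimannButzerHahn.
Context {R : realType}.
Implicit Types p q x : R.

Definition pq_int p q (n : nat) : R := (p ^+ n - q ^+ n) / (p - q).

Definition pq_fact p q (n : nat) : R := \prod_(1 <= i < n.+1) pq_int p q i.

Definition pq_binom p q (n k : nat) : R :=
  pq_fact p q n / (pq_fact p q k * pq_fact p q (n - k)).

Definition pq_ell p q (n : nat) x : R := \prod_(0 <= s < n) (p ^+ s + q ^+ s * x).

Definition pq_BBH p q (n : nat) (f : R -> R) x : R :=
  (pq_ell p q n x)^-1 *
  \sum_(0 <= k < n.+1)
    f (p ^+ (n - k + 1) * pq_int p q k / (pq_int p q (n - k + 1) * q ^+ k)) *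
    p ^+ ((n - k) * (n - k - 1))./2 * q ^+ (k * (k - 1))./2 *
    pq_binom p q n k * x ^+ k.

End BleimannButzerHahn.

(* Main.v *)
Require Import Defs.
From mathcomp Require Import all_boot all_order all_algebra.
From mathcomp Require Import all_classical all_reals all_analysis.
From mathcomp Require Import ring lra.
Import Order.TTheory GRing.Theory Num.Theory.
Import numFieldNormedType.Exports.

Local Open Scope classical_set_scope.
Local Open Scope ring_scope.

(** Write [k] for the (p,q)-integer and put t = x / (1 + x). The map
    y |-> y / (1 + y) sends the k-th node of the operator to
    t_k = p ^ (n - k + 1) [k] / [n + 1], because
    [n + 1] = p ^ (n - k + 1) [k] + q ^ k [n - k + 1]. The operator is an average
    of the values of f at the nodes, so for f in H_omega the error at x is at
    most the average of omega |t_k - t|, and everything reduces to the first two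
    moments of the t_k.

    These moments come from the absorption rule [k] C(n, k) = [n] C(n - 1, k - 1)
    for (p,q)-binomials. Used on both indices it also proves the (p,q)-binomial
    theorem (pq_hom1), which says that the weights sum to 1. With
    C = p [n] / [n + 1] the mean of the t_k is C t, and the second moment is at most
    C (p ^ n / [n + 1]) t (1 - t) + C ^ 2 t ^ 2. Since
    1 - C = q ^ n / [n + 1] <= p ^ n / [n + 1] <= 1, the mean square of t_k - t is
    at most 2 p ^ n / [n + 1], uniformly in x (BBH_variance).

    This quantity tends to 0: for a fixed m and all n >= m it is at most
    2 / ((m + 1) q ^ m) (pq_int_decay), which is near 2 / (m + 1) when q is near 1.

    Finally omega |u| <= omega d + (omega 1 / d ^ 2) u ^ 2 for |u| <= 1, as in
    Chebyshev's inequality. Averaging gives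
    |L f - f| <= omega d + (omega 1 / d ^ 2) 2 p ^ n / [n + 1] (pq_BBH_dist_le);
    d is chosen first to make omega d small, and then n. *)

(** * (p,q)-integers and the moments of the binomial weights *)

Section PQWeights.
Set Implicit Arguments.
Unset Strict Implicit.
Context {R : realType} (p q : R) (q_gt0 : 0 < q) (lt_qp : q < p).
Implicit Types (a x : R) (n k : nat).

Local Notation "[ n ]_pq" := (pq_int p q n) (at level 0, format "[ n ]_pq").

Let p_gt0 : 0 < p. Proof. exact: lt_trans lt_qp. Qed.
Let p_ge0 : 0 <= p. Proof. exact: ltW. Qed.
Let q_ge0 : 0 <= q. Proof. exact: ltW. Qed.
Let pBq_neq0 : p - q != 0. Proof. by rewrite subr_eq0 gt_eqF. Qed.

Lemma pq_int0 : [0]_pq = 0.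
Proof. by rewrite /pq_int !expr0 subrr mul0r. Qed.

Lemma pq_intD m k : [m + k]_pq = p ^+ m * [k]_pq + q ^+ k * [m]_pq.
Proof. by rewrite /pq_int !exprD; field. Qed.

Lemma pq_int_recl n : [n.+1]_pq = p ^+ n + q * [n]_pq.
Proof. by rewrite /pq_int !exprS; field. Qed.

Lemma pq_int_recr n : [n.+1]_pq = p * [n]_pq + q ^+ n.
Proof. by rewrite /pq_int !exprS; field. Qed.

Lemma pq_int_ge0 n : 0 <= [n]_pq.
Proof.
elim: n => [|n IHn]; first by rewrite pq_int0.
by rewrite pq_int_recl addr_ge0 ?exprn_ge0 // mulr_ge0.
Qed.

Lemma pq_int_gt0 n : 0 < [n.+1]_pq.
Proof.
by rewrite pq_int_recl ltr_pwDl ?exprn_gt0 // mulr_ge0 ?pq_int_ge0.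
Qed.

Lemma pq_factS n : pq_fact p q n.+1 = pq_fact p q n * [n.+1]_pq.
Proof. by rewrite /pq_fact big_nat_recr. Qed.

Lemma pq_fact_gt0 n : 0 < pq_fact p q n.
Proof.
elim: n => [|n IHn]; first by rewrite /pq_fact big_geq.
by rewrite pq_factS mulr_gt0 ?pq_int_gt0.
Qed.

Definition pq_coef n k : R :=
  p ^+ 'C(n - k, 2) * q ^+ 'C(k, 2) * pq_binom p q n k.

Lemma pq_coef_ge0 n k : 0 <= pq_coef n k.
Proof.
by rewrite /pq_coef /pq_binom !mulr_ge0 ?invr_ge0 ?mulr_ge0 ?exprn_ge0 //
  ltW ?pq_fact_gt0.
Qed.

(** The (p,q)-analogue of k C(n, k) = n C(n - 1, k - 1); the factor [q ^+ k] is
    what the exponent ['C(k, 2)] loses when [k] drops by one. *)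
Lemma pq_coef_absorbl n k : (k <= n)%N ->
  pq_coef n.+1 k.+1 * [k.+1]_pq = [n.+1]_pq * q ^+ k * pq_coef n k.
Proof.
move=> le_kn; rewrite /pq_coef /pq_binom subSS (binS k) bin1 exprD !pq_factS.
have := pq_fact_gt0 k; have := pq_fact_gt0 (n - k); have := pq_int_gt0 k.
by move=> *; field; rewrite !gt_eqF.
Qed.

Lemma pq_coef_absorbr n k : (k <= n)%N ->
  pq_coef n.+1 k * [n.+1 - k]_pq = [n.+1]_pq * p ^+ (n - k) * pq_coef n k.
Proof.
move=> le_kn; rewrite /pq_coef /pq_binom subSn // (binS (n - k)) bin1 exprD.
rewrite !pq_factS.
have := pq_fact_gt0 k; have := pq_fact_gt0 (n - k); have := pq_int_gt0 (n - k).
by move=> *; field; rewrite !gt_eqF.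
Qed.

(** An unnormalised average of [g] against the binomial weights. The variable [a]
    makes it homogeneous in [(a, x)]: multiplying [g k] by [p ^+ (n - k)] or
    [q ^+ k] then amounts to rescaling [a] or [x], and recurrences on [n] need no
    division. *)
Definition pq_hom n a x (g : nat -> R) : R :=
  \sum_(k < n.+1) pq_coef n k * a ^+ (n - k) * x ^+ k * g k.

Lemma pq_hom_absorbl n a x g :
  pq_hom n.+1 a x (fun k => [k]_pq * g k) =
  [n.+1]_pq * x * pq_hom n a (q * x) (g \o succn).
Proof.
rewrite /pq_hom big_ord_recl /= pq_int0 mul0r mulr0 add0r mulr_sumr.
apply: eq_bigr => k _; rewrite /bump /= add1n subSS exprMn exprS.
have := pq_coef_absorbl (ltn_ord k : (k <= n)%N) => E.
transitivity (pq_coef n.+1 k.+1 * [k.+1]_pq * a ^+ (n - k) * (x * x ^+ k) * g k.+1).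
  by ring.
by rewrite E; ring.
Qed.

Lemma pq_hom_absorbr n a x g :
  pq_hom n.+1 a x (fun k => [n.+1 - k]_pq * g k) =
  [n.+1]_pq * a * pq_hom n (p * a) x g.
Proof.
rewrite /pq_hom big_ord_recr /= subnn pq_int0 mul0r mulr0 addr0 mulr_sumr.
apply: eq_bigr => k _; rewrite exprMn.
have le_kn : (k <= n)%N := ltn_ord k.
have E := pq_coef_absorbr le_kn.
transitivity (pq_coef n.+1 k * [n.+1 - k]_pq * a ^+ (n.+1 - k) * x ^+ k * g k).
  by ring.
by rewrite E subSn // exprS; ring.
Qed.

Lemma eq_pq_hom n a x g h : (forall k, (k <= n)%N -> g k = h k) ->
  pq_hom n a x g = pq_hom n a x h.
Proof. by move=> E; apply: eq_bigr => k _; rewrite E // -ltnS. Qed.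

Lemma pq_homD n a x g h :
  pq_hom n a x (fun k => g k + h k) = pq_hom n a x g + pq_hom n a x h.
Proof. by rewrite -big_split; apply: eq_bigr => k _; rewrite mulrDr. Qed.

Lemma pq_homZ n a x c g :
  pq_hom n a x (fun k => c * g k) = c * pq_hom n a x g.
Proof. by rewrite mulr_sumr; apply: eq_bigr => k _; rewrite mulrCA. Qed.

Lemma pq_hom_scalel n a x g :
  pq_hom n a x (fun k => p ^+ (n - k) * g k) = pq_hom n (p * a) x g.
Proof. by apply: eq_bigr => k _; rewrite exprMn; ring. Qed.

Lemma pq_hom_scaler n a x g :
  pq_hom n a x (fun k => q ^+ k * g k) = pq_hom n a (q * x) g.
Proof. by apply: eq_bigr => k _; rewrite exprMn; ring. Qed.

(** Splitting [n + 1] into p ^ (n + 1 - k) [k] + q ^ k [n + 1 - k] under the sum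
    lets both absorption rules apply, and each half contains the same rescaled
    sum of order [n]. *)
Lemma pq_hom_rec n a x :
  pq_hom n.+1 a x (fun=> 1) = (a + x) * pq_hom n (p * a) (q * x) (fun=> 1).
Proof.
apply: (mulfI (lt0r_neq0 (pq_int_gt0 n))).
rewrite -[LHS]pq_homZ (@eq_pq_hom _ _ _ _ (fun k => p ^+ (n.+1 - k) * ([k]_pq * 1) +
  q ^+ k * ([n.+1 - k]_pq * 1))); last first.
  move=> k le_kn; have := pq_intD (n.+1 - k) k.
  by rewrite subnK // => ->; ring.
rewrite pq_homD pq_hom_scalel pq_hom_scaler pq_hom_absorbl pq_hom_absorbr.
by rewrite /comp; ring.
Qed.

Lemma pq_hom1 n a x :
  pq_hom n a x (fun=> 1) = \prod_(0 <= s < n) (p ^+ s * a + q ^+ s * x).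
Proof.
elim: n a x => [|n IHn] a x.
  rewrite /pq_hom big_ord1 big_geq // /pq_coef /pq_binom /pq_fact !big_geq //.
  by rewrite !expr0 /=; field.
rewrite pq_hom_rec IHn big_nat_recl // !expr0 !mul1r; congr (_ * _).
by apply: eq_bigr => s _; rewrite !exprS; ring.
Qed.

(** The factor [a + x] stays on the left to keep the identity polynomial; it
    comes from comparing absorption with the recurrence [pq_hom_rec]. *)
Lemma pq_hom_moment1 n a x :
  (a + x) * pq_hom n a x (fun k => p ^+ (n - k) * [k]_pq) =
  [n]_pq * x * pq_hom n a x (fun=> 1).
Proof.
case: n => [|n].
  by rewrite pq_int0 !mul0r /pq_hom big_ord1 pq_int0 !mulr0.
rewrite pq_hom_scalel (@eq_pq_hom _ _ _ _ (fun k => [k]_pq * 1)); last first.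
  by move=> k _; rewrite mulr1.
by rewrite pq_hom_absorbl pq_hom_rec /comp; ring.
Qed.

(** One factor [k] of the square is absorbed; the other, which has become
    [k + 1], splits as p ^ k + q [k], leaving a sum of order 0 and one of
    order 1. *)
Lemma pq_hom_moment2 n a x :
  pq_hom n.+1 a x (fun k => (p ^+ (n.+1 - k) * [k]_pq) ^+ 2) =
  [n.+1]_pq * x * (p ^+ n * pq_hom n (p * a) (q * x) (fun=> 1) +
    q * pq_hom n (p * a) (q * x) (fun k => p ^+ (n - k) * [k]_pq)).
Proof.
rewrite (@eq_pq_hom _ _ _ _ (fun k => p ^+ (n.+1 - k) *
  ([k]_pq * (p ^+ (n.+1 - k) * [k]_pq)))); last by move=> k _; ring.
rewrite pq_hom_scalel pq_hom_absorbl.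
rewrite -[p ^+ n * _]pq_homZ -[q * pq_hom _ _ _ _]pq_homZ -pq_homD.
congr (_ * _).
apply: eq_pq_hom => k le_kn; rewrite /= subSS pq_int_recl mulrDr -exprD subnK //.
by ring.
Qed.

End PQWeights.

(** * The operator as an average over its nodes *)

Section BBHMean.
Set Implicit Arguments.
Unset Strict Implicit.
Context {R : realType} (p q : R) (q_gt0 : 0 < q) (lt_qp : q < p).
Implicit Types (f : R -> R) (g h : nat -> R) (x c : R) (n k : nat).

Local Notation "[ n ]_pq" := (pq_int p q n) (at level 0, format "[ n ]_pq").

Let p_gt0 : 0 < p. Proof. exact: lt_trans lt_qp. Qed.
Let p_ge0 : 0 <= p. Proof. exact: ltW. Qed.
Let q_ge0 : 0 <= q. Proof. exact: ltW. Qed.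

Lemma pq_ell_gt0 n x : 0 <= x -> 0 < pq_ell p q n x.
Proof.
move=> x_ge0; rewrite /pq_ell; apply: prodr_gt0 => s _.
by rewrite ltr_pwDl ?exprn_gt0 // mulr_ge0 // exprn_ge0.
Qed.

Lemma pq_ellE n x : pq_hom p q n 1 x (fun=> 1) = pq_ell p q n x.
Proof. by rewrite pq_hom1 //; apply: eq_bigr => s _; rewrite mulr1. Qed.

Definition pq_mean n x g : R := (pq_ell p q n x)^-1 * pq_hom p q n 1 x g.

Definition BBH_node n k : R :=
  p ^+ (n - k + 1) * [k]_pq / ([n - k + 1]_pq * q ^+ k).

Lemma pq_BBHE n f x : pq_BBH p q n f x = pq_mean n x (f \o BBH_node n).
Proof.
rewrite /pq_BBH /pq_mean /pq_hom big_mkord; congr (_ * _).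
apply: eq_bigr => k _; rewrite /= /pq_coef /BBH_node !bin2 !subn1 expr1n.
by ring.
Qed.

Lemma pq_meanD n x g h :
  pq_mean n x (fun k => g k + h k) = pq_mean n x g + pq_mean n x h.
Proof. by rewrite /pq_mean pq_homD mulrDr. Qed.

Lemma pq_meanZ n x c g : pq_mean n x (fun k => c * g k) = c * pq_mean n x g.
Proof. by rewrite /pq_mean pq_homZ mulrCA. Qed.

Lemma pq_mean_cst n x c : 0 <= x -> pq_mean n x (fun=> c) = c.
Proof.
move=> x_ge0; rewrite -[in LHS](mulr1 c) pq_meanZ /pq_mean pq_ellE.
by rewrite mulVf ?mulr1 // gt_eqF // pq_ell_gt0.
Qed.

Lemma le_pq_mean n x g h : 0 <= x -> (forall k, (k <= n)%N -> g k <= h k) ->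
  pq_mean n x g <= pq_mean n x h.
Proof.
move=> x_ge0 le_gh; rewrite /pq_mean ler_wpM2l ?invr_ge0 //.
  by rewrite ltW // pq_ell_gt0.
have le_kn k : (k < n.+1)%N -> (k <= n)%N by [].
apply: ler_sum => k _; rewrite ler_wpM2l ?le_gh ?le_kn //.
by rewrite expr1n mulr1 mulr_ge0 ?pq_coef_ge0 // exprn_ge0.
Qed.

Lemma pq_BBH_dist n f x : 0 <= x ->
  `|pq_BBH p q n f x - f x| <=
  pq_mean n x (fun k => `|f (BBH_node n k) - f x|).
Proof.
move=> x_ge0.
have -> : pq_BBH p q n f x - f x = pq_mean n x (fun k => f (BBH_node n k) - f x).
  by rewrite pq_BBHE pq_meanD pq_mean_cst.
rewrite ler_norml -mulN1r -pq_meanZ; apply/andP.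
split; apply: le_pq_mean => // k _; last exact: ler_norm.
by rewrite mulN1r lerNnormlW.
Qed.

Lemma BBH_node_ge0 n k : 0 <= BBH_node n k.
Proof.
by rewrite /BBH_node divr_ge0 // mulr_ge0 ?exprn_ge0 // pq_int_ge0.
Qed.

(** The image of [BBH_node n k] under y |-> y / (1 + y), see [BBH_ratioE]. The
    power of [p] is split so that the second factor is the one whose moments are
    computed above. *)
Definition BBH_ratio n k : R := p / [n.+1]_pq * (p ^+ (n - k) * [k]_pq).

Lemma BBH_ratioE n k : (k <= n)%N ->
  BBH_node n k / (1 + BBH_node n k) = BBH_ratio n k.
Proof.
move=> le_kn; have := pq_intD lt_qp (n - k + 1) k.
have -> : (n - k + 1 + k = n.+1)%N by rewrite addnAC subnK ?addn1.
rewrite /BBH_ratio /BBH_node addn1 => E.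
have P_gt0 : 0 < [n.+1]_pq by exact: pq_int_gt0.
have D_gt0 : 0 < [(n - k).+1]_pq by exact: pq_int_gt0.
have Q_gt0 : 0 < q ^+ k by exact: exprn_gt0.
move: E P_gt0; rewrite exprS => -> P_gt0.
by field; rewrite !gt_eqF //= mulrC [_ * q ^+ k]mulrC addrC.
Qed.

Lemma pq_mean_ratio n x : 0 <= x ->
  pq_mean n x (BBH_ratio n) = p * [n]_pq / [n.+1]_pq * (x / (1 + x)).
Proof.
move=> x_ge0; rewrite pq_meanZ /pq_mean.
have ell_gt0 := pq_ell_gt0 n x_ge0; have P_gt0 := pq_int_gt0 q_gt0 lt_qp n.
have x1_gt0 : 0 < 1 + x by rewrite ltr_pwDl.
have := pq_hom_moment1 q_gt0 lt_qp n 1 x.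
rewrite pq_ellE => /(canRL (mulKf (lt0r_neq0 x1_gt0))) ->.
by field; rewrite !gt_eqF.
Qed.

(** The exact second moment has q x / (p + q x) in place of the last x / (1 + x);
    it is smaller because q < p. *)
Lemma pq_mean_sqr_le n x : 0 <= x ->
  pq_mean n.+1 x (fun k => (p ^+ (n.+1 - k) * [k]_pq) ^+ 2) <=
  [n.+1]_pq * (x / (1 + x)) * (p ^+ n + q * [n]_pq * (x / (1 + x))).
Proof.
move=> x_ge0; have ell_gt0 := pq_ell_gt0 n.+1 x_ge0.
have x1_gt0 : 0 < 1 + x by rewrite ltr_pwDl.
have pqx_gt0 : 0 < p + q * x by rewrite ltr_pwDl // mulr_ge0.
rewrite /pq_mean mulrC ler_pdivrMr // pq_hom_moment2 // !mulr1.
have hE := pq_hom_rec q_gt0 lt_qp n 1 x.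
rewrite pq_ellE mulr1 in hE.
have := pq_hom_moment1 q_gt0 lt_qp n p (q * x).
move=> /(canRL (mulKf (lt0r_neq0 pqx_gt0))) ->.
rewrite hE; set h := pq_hom _ _ _ _ _ _.
have h_gt0 : 0 < h by move: ell_gt0; rewrite hE pmulr_rgt0.
have S_ge0 : 0 <= [n]_pq by exact: pq_int_ge0.
have Q_ge0 : 0 <= [n.+1]_pq by exact: pq_int_ge0.
have -> : [n.+1]_pq * (x / (1 + x)) * (p ^+ n + q * [n]_pq * (x / (1 + x))) *
  ((1 + x) * h) = [n.+1]_pq * x * h * (p ^+ n + q * [n]_pq * (x / (1 + x))).
  by field; rewrite gt_eqF.
have -> : [n.+1]_pq * x * (p ^+ n * h + q * ((p + q * x)^-1 *
  ([n]_pq * (q * x) * h))) =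
  [n.+1]_pq * x * h * (p ^+ n + q * [n]_pq * (q * x / (p + q * x))).
  by field; rewrite gt_eqF.
have c_ge0 : 0 <= [n.+1]_pq * x * h.
  by apply: mulr_ge0; [exact: mulr_ge0 | exact: ltW].
have d_ge0 : 0 <= q * [n]_pq by exact: mulr_ge0.
rewrite ler_wpM2l // lerD2l ler_wpM2l //.
have le_xqp : x * q <= x * p by rewrite ler_wpM2l // ltW.
rewrite ler_pdivrMr // mulrAC ler_pdivlMr //; lra.
Qed.

Lemma ratio01 x : 0 <= x -> 0 <= x / (1 + x) <= 1.
Proof.
move=> x_ge0; have x1_gt0 : 0 < 1 + x by rewrite ltr_pwDl.
by rewrite divr_ge0 ?(ltW x1_gt0) //= ler_pdivrMr // mul1r lerDr.
Qed.

(** Expanding the square and using q [n] = [n + 1] - p ^ n to eliminate [n], the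
    bound on the second moment turns into C r t (1 - t) + (1 - C) ^ 2 t ^ 2 with
    C = p [n + 1] / [n + 2] and r = p ^ (n + 1) / [n + 2]. Both terms are at most r,
    the second one because 1 - C = q ^ (n + 1) / [n + 2] <= r <= 1. *)
Lemma BBH_variance n x : 0 <= x ->
  pq_mean n.+1 x (fun k => (BBH_ratio n.+1 k - x / (1 + x)) ^+ 2) <=
  2 * (p ^+ n.+1 / [n.+2]_pq).
Proof.
move=> x_ge0; set t := x / (1 + x).
have [t_ge0 t_le1] := andP (ratio01 x_ge0).
set P := [n.+2]_pq; have P_gt0 : 0 < P by exact: pq_int_gt0.
have -> : pq_mean n.+1 x (fun k => (BBH_ratio n.+1 k - t) ^+ 2) =
  (p / P) ^+ 2 * pq_mean n.+1 x (fun k => (p ^+ (n.+1 - k) * [k]_pq) ^+ 2) +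
  ((- 2 * t) * pq_mean n.+1 x (BBH_ratio n.+1) + t ^+ 2).
  rewrite -[t ^+ 2 in RHS](pq_mean_cst n.+1 _ x_ge0) -!pq_meanZ -!pq_meanD.
  congr (pq_mean _ _ _); apply: funext => k; rewrite /BBH_ratio -/P; ring.
rewrite pq_mean_ratio // -/t -/P.
have := pq_mean_sqr_le n x_ge0; rewrite -/t.
move/(ler_wpM2l (sqr_ge0 (p / P))) => H.
rewrite (le_trans (lerD H (lexx _))) // => {H}.
have Q_ge0 : 0 <= [n.+1]_pq by exact: pq_int_ge0.
have S_ge0 : 0 <= [n]_pq by exact: pq_int_ge0.
have pn_ge0 : 0 <= p ^+ n by exact: exprn_ge0.
have PE : P = p * [n.+1]_pq + q ^+ n.+1 by exact: pq_int_recr.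
have PE' : P = p ^+ n.+1 + q * [n.+1]_pq by exact: pq_int_recl.
have QE : [n.+1]_pq = p ^+ n + q * [n]_pq by exact: pq_int_recl.
have qp_le : q ^+ n.+1 <= p ^+ n.+1 by rewrite lerXn2r ?nnegrE // ltW.
have qn_ge0 : 0 <= q ^+ n.+1 by exact: exprn_ge0.
pose C := p * [n.+1]_pq / P; pose r := p ^+ n.+1 / P; pose s := q ^+ n.+1 / P.
have pQ_ge0 : 0 <= p * [n.+1]_pq by exact: mulr_ge0.
have qQ_ge0 : 0 <= q * [n.+1]_pq by exact: mulr_ge0.
have C_ge0 : 0 <= C by rewrite divr_ge0 // ltW.
have s_ge0 : 0 <= s by rewrite divr_ge0 // ltW.
have CsE : C + s = 1 by rewrite /C /s -mulrDl -PE divff // gt_eqF.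
have sr : s <= r by rewrite ler_pM2r // invr_gt0.
have r_le1 : r <= 1 by rewrite ler_pdivrMr // mul1r PE' lerDl.
have -> : (p / P) ^+ 2 * ([n.+1]_pq * t * (p ^+ n + q * [n]_pq * t)) +
  (-2 * t * (p * [n.+1]_pq / P * t) + t ^+ 2) =
  C * r * t + (1 - C) ^+ 2 * t ^+ 2 - C * r * t ^+ 2.
  have -> : q * [n]_pq = [n.+1]_pq - p ^+ n by rewrite QE addrAC subrr add0r.
  by rewrite /C /r (exprS p n); field; rewrite gt_eqF.
have -> : 1 - C = s by rewrite -CsE addrAC subrr add0r.
have C_le1 : C <= 1 by rewrite -CsE lerDl.
have r_ge0 : 0 <= r := le_trans s_ge0 sr.
have Cr_ge0 : 0 <= C * r by exact: mulr_ge0.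
have Crt2_ge0 : 0 <= C * r * t ^+ 2 by rewrite mulr_ge0 // sqr_ge0.
have : C * r * t <= 1 * r * 1 by rewrite ler_pM // ler_wpM2r.
have : s ^+ 2 * t ^+ 2 <= r * 1 * 1.
  have s_le1 : s <= 1 := le_trans sr r_le1.
  rewrite mulr1 ler_pM ?sqr_ge0 //; last by rewrite exprn_ile1.
  by rewrite expr2 -[r]mulr1 ler_pM.
rewrite -/r; move: Crt2_ge0; lra.
Qed.

Lemma pq_int_ge n : n.+1%:R * q ^+ n <= [n.+1]_pq.
Proof.
elim: n => [|n IHn].
  by rewrite pq_int_recl // pq_int0 mulr0 addr0 !expr0 mulr1.
rewrite pq_int_recr // -addn1 natrD mulrDl mul1r lerD2r exprS mulrCA.
by rewrite ler_pM ?mulr_ge0 ?exprn_ge0 // ltW.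
Qed.

(** [n + 1] is at least its part p ^ (n - m) [m + 1], so p ^ n / [n + 1] is at most
    p ^ m / [m + 1]: the bound depends on [n] only through [p] and [q], which makes
    it usable when these vary with [n]. *)
Lemma pq_int_decay m n : (m <= n)%N -> p <= 1 ->
  p ^+ n / [n.+1]_pq <= (m.+1%:R * q ^+ m)^-1.
Proof.
move=> le_mn p_le1; have P_gt0 := pq_int_gt0 q_gt0 lt_qp n.
have d_gt0 : 0 < m.+1%:R * q ^+ m by rewrite mulr_gt0 ?ltr0n ?exprn_gt0.
rewrite ler_pdivrMr // mulrC ler_pdivlMr //.
have := pq_intD lt_qp (n - m) m.+1; rewrite addnS subnK // => ->.
rewrite -[leLHS]addr0 lerD //; last first.
  by apply: mulr_ge0; [exact: exprn_ge0 | exact: pq_int_ge0].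
rewrite ler_pM ?exprn_ge0 ?(ltW d_gt0) ?pq_int_ge //.
by rewrite ler_wiXn2l ?leq_subr.
Qed.

End BBHMean.

(** * Functions controlled by a modulus of continuity *)

Section Modulus.
Set Implicit Arguments.
Unset Strict Implicit.
Context {R : realType} (omega : R -> R) (homega : modulus_of_continuity omega).
Context (f : R -> R) (hf : in_H omega f).

Lemma modulus_small e : 0 < e -> exists2 d, 0 < d & omega d <= e.
Proof.
move=> e_gt0; have [om_ge0 _ _ /cvgrPdist_le/(_ _ e_gt0) om_cvg] := homega.
have [d [d_gt0 om_d]] := filter_ex (filterI (nbhs_right_gt (0 : R)) om_cvg).
exists d => //; move: om_d; rewrite sub0r normrN.
exact: le_trans (ler_norm _).
Qed.

Lemma ratio_dist (x y : R) : 0 <= x -> 0 <= y ->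
  `|x / (1 + x) - y / (1 + y)| <= `|x - y|.
Proof.
move=> x_ge0 y_ge0.
have x1_gt0 : 0 < 1 + x by rewrite ltr_pwDl.
have y1_gt0 : 0 < 1 + y by rewrite ltr_pwDl.
have -> : x / (1 + x) - y / (1 + y) = (x - y) / ((1 + x) * (1 + y)).
  by field; rewrite !gt_eqF.
rewrite normrM normfV [`|(1 + x) * _|]gtr0_norm ?mulr_gt0 //.
rewrite ler_pdivrMr ?mulr_gt0 // ler_peMr //; nra.
Qed.

Lemma ratio_dist_le1 (x y : R) : 0 <= x -> 0 <= y ->
  `|x / (1 + x) - y / (1 + y)| <= 1.
Proof.
move=> /ratio01/andP[? ?] /ratio01/andP[? ?]; rewrite ler_norml; lra.
Qed.

Lemma in_H_continuous : {within `[0, +oo[, continuous f}.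
Proof.
have [om_ge0 om_le _ _] := homega.
apply/subspace_continuousP => x /=; rewrite in_itv /= andbT => x_ge0.
apply/cvgrPdist_le => e /modulus_small[d d_gt0 om_d].
rewrite near_withinE; near=> y; rewrite /= in_itv /= andbT => y_ge0.
apply: le_trans (hf x_ge0 y_ge0) _; apply: le_trans om_d.
apply: om_le => //; apply: le_trans (ratio_dist x_ge0 y_ge0) _.
near: y; apply: (@cvgr_dist_le _ _ _ _ _ id x) => //; exact: cvg_id.
Unshelve. all: by end_near. Qed.

Context (p q : R) (q_gt0 : 0 < q) (lt_qp : q < p).

Lemma BBH_node_dist n x k : (k <= n)%N -> 0 <= x ->
  `|f (BBH_node p q n k) - f x| <= omega `|BBH_ratio p q n k - x / (1 + x)|.
Proof.
move=> le_kn x_ge0; rewrite -BBH_ratioE //; apply: hf => //.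
exact: BBH_node_ge0.
Qed.

Lemma pq_BBH_bounded n x : 0 <= x -> `|pq_BBH p q n f x - f x| <= omega 1.
Proof.
have [om_ge0 om_le _ _] := homega.
move=> x_ge0; apply: le_trans (pq_BBH_dist _ _ _ _ _) _ => //.
rewrite -(pq_mean_cst q_gt0 lt_qp n (omega 1) x_ge0).
apply: le_pq_mean => // k le_kn; apply: le_trans (BBH_node_dist le_kn x_ge0) _.
by apply: om_le => //; rewrite -BBH_ratioE // ratio_dist_le1 // BBH_node_ge0.
Qed.

(** Chebyshev's argument: where |t_k - t| <= d the modulus is at most [omega d],
    and elsewhere it is at most [omega 1] <= [omega 1 / d ^+ 2 * (t_k - t) ^+ 2]. *)
Lemma pq_BBH_dist_le n x d : (0 < n)%N -> 0 < d -> 0 <= x ->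
  `|pq_BBH p q n f x - f x| <=
  omega d + omega 1 / d ^+ 2 * (2 * (p ^+ n / pq_int p q n.+1)).
Proof.
have [om_ge0 om_le _ _] := homega.
case: n => // n _ d_gt0 x_ge0; apply: le_trans (pq_BBH_dist _ _ _ _ _) _ => //.
have c_ge0 : 0 <= omega 1 / d ^+ 2 by rewrite divr_ge0 ?om_ge0 ?sqr_ge0.
apply: (le_trans _ (lerD (lexx _)
  (ler_wpM2l c_ge0 (BBH_variance q_gt0 lt_qp n x_ge0)))).
rewrite -[X in X + _](pq_mean_cst q_gt0 lt_qp n.+1 (omega d) x_ge0).
rewrite -pq_meanZ -pq_meanD; apply: le_pq_mean => // k le_kn.
apply: le_trans (BBH_node_dist le_kn x_ge0) _.
set u := BBH_ratio _ _ _ _ - _.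
have u_le1 : `|u| <= 1 by rewrite /u -BBH_ratioE // ratio_dist_le1 // BBH_node_ge0.
have [u_d|d_u] := leP `|u| d.
  by rewrite (le_trans (om_le _ _ _ u_d)) // lerDl mulr_ge0 // sqr_ge0.
rewrite (le_trans (om_le _ _ _ u_le1)) //.
rewrite (@le_trans _ _ (omega 1 / d ^+ 2 * u ^+ 2)) ?lerDr ?om_ge0 ?(ltW d_gt0) //.
rewrite mulrAC ler_pdivlMr ?exprn_gt0 // ler_wpM2l ?om_ge0 //.
by rewrite -[u ^+ 2]real_normK ?num_real // lerXn2r ?nnegrE // ltW.
Qed.

Lemma pq_BBH_in_CB n : in_CB (fun x => pq_BBH p q n f x - f x).
Proof.
split.
  apply/subspace_continuousP => x x_itv.
  have x_ge0 : 0 <= x by move: x_itv; rewrite /= in_itv /= andbT.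
  apply: cvgB; last exact: (subspace_continuousP _ _).1 in_H_continuous x x_itv.
  apply: cvg_within_filter; apply: cvgM.
    apply: cvgV; first by rewrite gt_eqF // pq_ell_gt0.
    apply: cvg_big => [|s _]; first exact: mul_continuous.
    by apply: cvgD; [exact: cvg_cst | apply: cvgMr; exact: cvg_id].
  apply: cvg_big => [|k _]; first exact: add_continuous.
  by apply: cvgMr; exact: exprn_continuous.
exists (omega 1); split; first exact: num_real.
move=> M om_M x; rewrite /= in_itv /= andbT => x_ge0.
exact: le_trans (pq_BBH_bounded n x_ge0) (ltW om_M).
Qed.

End Modulus.

(** * Uniform convergence *)

Theorem theorem2p2 (R : realType) (p q : nat -> R)
  (hpq : forall n : nat, (1 <= n)%N -> [/\ 0 < q n, q n < p n & p n <= 1])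
  (hp : p n @[n --> \oo] --> (1 : R))
  (hq : q n @[n --> \oo] --> (1 : R))
  (omega : R -> R) (homega : modulus_of_continuity omega)
  (f : R -> R) (hf : in_H omega f) :
  (forall n : nat, (1 <= n)%N ->
     in_CB (fun x => pq_BBH (p n) (q n) n f x - f x)) /\
  normCB (fun x => pq_BBH (p n) (q n) n f x - f x) @[n --> \oo] --> (0 : R).
Proof.
split=> [n n_gt0|].
  by have [q_gt0 lt_qp _] := hpq _ n_gt0; exact: (pq_BBH_in_CB homega).
have [om_ge0 om_le _ _] := homega.
apply/cvgrPdist_le => e e_gt0.
have [d d_gt0 om_d] := modulus_small homega (divr_gt0 e_gt0 (ltr0n R 2)).
pose K := omega 1 / d ^+ 2.
have K_ge0 : 0 <= K by rewrite divr_ge0 ?om_ge0 ?sqr_ge0.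
(* Once q n ^+ m >= 1 / 2 the variance bound 2 / ((m + 1) * q n ^+ m) is at most
   4 / (m + 1); the constant 8 makes K times this at most e / 2. *)
have [m m_gt] : exists m : nat, 8 * K / e <= m.+1%:R.
  by exists (Num.truncn (8 * K / e)); rewrite ltW // truncnS_gt.
have qm_cvg : (q n ^+ m) @[n --> \oo] --> (1 : R).
  rewrite -(expr1n R m); exact: (cvg_comp q (fun x => x ^+ m) hq (@exprn_continuous R m 1)).
near=> n.
have n_gt0 : (0 < n)%N by near: n; exact: nbhs_infty_gt.
have le_mn : (m <= n)%N by near: n; exact: nbhs_infty_ge.
have [q_gt0 lt_qp p_le1] := hpq _ n_gt0.
have qm_ge : 1 / 2 <= q n ^+ m.
  have : `|1 - q n ^+ m| <= 1 / 2.
    by near: n; move/cvgrPdist_le: qm_cvg; apply; rewrite divr_gt0.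
  by rewrite ler_norml; lra.
have decay : K * (2 * (p n ^+ n / pq_int (p n) (q n) n.+1)) <= e / 2.
  have H := pq_int_decay q_gt0 lt_qp le_mn p_le1.
  have m_gt0 : (0 : R) < m.+1%:R by rewrite ltr0n.
  have : 8 * K <= m.+1%:R * e by rewrite -ler_pdivrMr.
  have : (m.+1%:R * q n ^+ m)^-1 <= 2 / m.+1%:R.
    rewrite -[leRHS]invrK lef_pV2 ?posrE ?invr_gt0 ?divr_gt0 ?mulr_gt0 //.
      by rewrite invf_div ler_wpM2l //; lra.
    by apply: lt_le_trans qm_ge; lra.
  move=> /(le_trans H) /(ler_wpM2l K_ge0) {}H Ke.
  have : K * (2 / m.+1%:R) <= e / 4 by rewrite mulrA ler_pdivrMr //; lra.
  by move=> /(le_trans H); rewrite mulrCA; lra.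
rewrite sub0r normrN /normCB.
have ub : ubound [set `|pq_BBH (p n) (q n) n f x - f x| |
    x in `[0, +oo[%classic] e.
  move=> _ [x x_itv <-].
  have x_ge0 : 0 <= x by move: x_itv; rewrite /= in_itv /= andbT.
  apply: le_trans (pq_BBH_dist_le homega hf q_gt0 lt_qp n_gt0 d_gt0 x_ge0) _.
  by move: om_d decay; rewrite /K; lra.
have mem0 : [set `|pq_BBH (p n) (q n) n f x - f x| | x in `[0, +oo[%classic]
    `|pq_BBH (p n) (q n) n f 0 - f 0|.
  by exists 0; rewrite //= in_itv /= lexx.
rewrite ger0_norm; first by apply: ge_sup => //; eexists; exact: mem0.
by apply: le_trans (ub_le_sup _ mem0) => //; exists e.
Unshelve. all: by end_near. Qed.
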